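(* Let $G=(V,(E_i)_{i\in[k]})$ be a multilayer network with positive edge weights $w_i\colon E_i\to\mathbb{R}_{>0}$ $(i\in[k])$, and let $\bm{\alpha}\in\mathbb{R}_{\ge 0}^k$ and $\bm{\beta}\in\mathbb{R}^k$. The LP-based algorithm (described in the context) outputs a hierarchical solution $\hat{p}$, i.e., for any $S,T\in\mathrm{supp}(\hat{p})$, $S\subseteq T$ or $S\supseteq T$ holds.
   Context: Notation: $[k]=\{1,\dots,k\}$ with $k\ge 1$. A multilayer network $G=(V,(E_i)_{i\in[k]})$ consists of a finite nonempty vertex set $V$ and, for each layer $i\in[k]$, a set $E_i$ of undirected edges $\{u,v\}$ ($u\neq v$, $u,v\in V$). Put $E=\bigcup_{i\in[k]}E_i$. $\Delta(2^V)$ is the set of probability distributions on $2^V$; for $p\in\Delta(2^V)$, $p_S$ is the probability of $S\subseteq V$, and $\mathrm{supp}(p)=\{S\subseteq V\mid p_S>0\}$. The LP, in real variables $((x_e)_{e\in E},(y_v)_{v\in V},t)$: maximize $t$ subject to $t\le\alpha_i\sum_{e\in E_i}w_i(e)x_e+\beta_i$ for all $i\in[k]$; $x_e\le y_u$ and $x_e\le y_v$ for all $e=\{u,v\}\in E$; $\sum_{v\in V}y_v=1$; $x_e\ge 0$ and $y_v\ge 0$ for all $e\in E$, $v\in V$. LP-based algorithm: (1) compute an optimal solution $((\hat{x}_e)_{e\in E},(\hat{y}_v)_{v\in V},\hat{t})$ to the LP. (2) Let $0=r_0<r_1<\cdots<r_\ell$ be the reals with $\{r_0,r_1,\dots,r_\ell\}=\{\hat{y}_v\mid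 v\in V\}\cup\{0\}$. (3) Let $S_j=\{v\in V\mid\hat{y}_v\ge r_j\}$ for $j=1,\dots,\ell$. (4) Return $\hat{p}\in\Delta(2^V)$ with $\hat{p}_{S_j}=(r_j-r_{j-1})\cdot|S_j|$ for $j=1,\dots,\ell$ and $\hat{p}_S=0$ for all other $S\subseteq V$. *)

(* Defs.v *)
From HB Require Import structures.
From mathcomp Require Import all_boot all_order all_algebra.
From mathcomp Require Import reals.

Set Implicit Arguments.
Unset Strict Implicit.
Unset Printing Implicit Defensive.

Import Order.TTheory GRing.Theory Num.Theory.
Local Open Scope ring_scope.

(* The layers are indexed by 'I_k; an undirected edge {u, v} with u != v is
   a two-element set of vertices. *)
Record multilayer_network (V : finType) (k : nat) := MultilayerNetwork {
  layer :> 'I_k -> {set {set V}};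
  layerP : forall i e, e \in layer i -> #|e| = 2%N
}.

Definition edges (V : finType) (k : nat) (G : multilayer_network V k) :
    {set {set V}} :=
  \bigcup_(i < k) G i.

Definition distribution (R : realType) (V : finType)
    (p : {ffun {set V} -> R}) : Prop :=
  (forall S, 0 <= p S) /\ \sum_S p S = 1.

Definition supp (R : realType) (V : finType) (p : {ffun {set V} -> R}) :
    {set {set V}} :=
  [set S | 0 < p S].

Definition hierarchical (R : realType) (V : finType)
    (p : {ffun {set V} -> R}) : Prop :=
  forall S T, S \in supp p -> T \in supp p -> S \subset T \/ T \subset S.

(* Families indexed by edges (w i, x) are total functions on {set V}; their
   values outside G i, respectively outside edges G, are never used. *)
Record lp_feasible (R : realType) (V : finType) (k : nat)
    (G : multilayer_network V k) (w : 'I_k -> {set V} -> R)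
    (alpha beta : 'I_k -> R)
    (x : {set V} -> R) (y : V -> R) (t : R) : Prop := LpFeasible {
  lp_layer : forall i, t <= alpha i * (\sum_(e in G i) w i e * x e) + beta i;
  lp_edge : forall e, e \in edges G -> forall v, v \in e -> x e <= y v;
  lp_sum : \sum_v y v = 1;
  lp_x_ge0 : forall e, e \in edges G -> 0 <= x e;
  lp_y_ge0 : forall v, 0 <= y v
}.

Definition lp_optimal (R : realType) (V : finType) (k : nat)
    (G : multilayer_network V k) (w : 'I_k -> {set V} -> R)
    (alpha beta : 'I_k -> R)
    (x : {set V} -> R) (y : V -> R) (t : R) : Prop :=
  lp_feasible G w alpha beta x y t /\
  forall x' y' t', lp_feasible G w alpha beta x' y' t' -> t' <= t.

(* The increasing enumeration r_0 < r_1 < ... < r_l of {y v | v} and 0; its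
   head r_0 is 0 because y is nonnegative in every feasible solution. *)
Definition levels (R : realType) (V : finType) (y : V -> R) : seq R :=
  sort <=%R (undup (0 :: [seq y v | v : V])).

Definition level (R : realType) (V : finType) (y : V -> R) (j : nat) : R :=
  nth 0 (levels y) j.

Definition level_set (R : realType) (V : finType) (y : V -> R) (j : nat) :
    {set V} :=
  [set v | level y j <= y v].

(* For j = 1, ..., l the sets S_j are pairwise distinct, so at most one index
   can be picked; j : 'I_l below stands for the index j.+1. *)
Definition lp_rounding (R : realType) (V : finType) (y : V -> R) :
    {ffun {set V} -> R} :=
  [ffun S =>
    if [pick j : 'I_(size (levels y)).-1 | S == level_set y j.+1] is Some j
    then (level y j.+1 - level y j) * #|level_set y j.+1|%:R
    else 0].

(* The algorithm may use any optimal solution of the LP, so its output is a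
   relation rather than a function of the instance. *)
Definition lp_algorithm_output (R : realType) (V : finType) (k : nat)
    (G : multilayer_network V k) (w : 'I_k -> {set V} -> R)
    (alpha beta : 'I_k -> R) (p : {ffun {set V} -> R}) : Prop :=
  exists x y t, lp_optimal G w alpha beta x y t /\ p = lp_rounding y.

(* Main.v *)
(** Exchanging sums gives [\sum_j (r_j - r_(j-1)) |S_j|
    = \sum_v \sum_(j | r_j <= y v) (r_j - r_(j-1))], and the inner sum
    telescopes to [y v], so the total mass is [\sum_v y v = 1].  The sets [S_j]
    decrease with [j], which makes the support a chain; they do so strictly,
    so no mass is lost by merging two indices. *)
Require Import Defs.
From HB Require Import structures.
From mathcomp Require Import all_boot all_order all_algebra.
From mathcomp Require Import reals.

Set Implicit Arguments.
Unset Strict Implicit.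
Unset Printing Implicit Defensive.

Import Order.TTheory GRing.Theory Num.Theory.
Local Open Scope ring_scope.

Section Levels.

Variables (R : realType) (V : finType) (y : V -> R).
Hypothesis y_ge0 : forall v, 0 <= y v.

Let l := (size (levels y)).-1.

(** The inserted 0 keeps the list nonempty, so the predecessor in [l] does not truncate. *)
Lemma size_levels : size (levels y) = l.+1.
Proof.
rewrite prednK // size_sort.
have : 0 \in undup (0 :: [seq y v | v : V]) by rewrite mem_undup mem_head.
by case: (undup _).
Qed.

Lemma mem_levels a : (a \in levels y) = (a \in 0 :: [seq y v | v : V]).
Proof. by rewrite mem_sort mem_undup. Qed.

(** Removing duplicates makes the sorted list strictly increasing, hence an equivalence and not just
    monotonicity. *)
Lemma level_le i j :
  (i <= l)%N -> (j <= l)%N -> (level y i <= level y j) = (i <= j)%N.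
Proof.
move=> il jl; apply: lt_sorted_leq_nth; rewrite ?inE ?size_levels ?ltnS //.
by rewrite sort_lt_sorted undup_uniq.
Qed.

Lemma level_lt i j :
  (i <= l)%N -> (j <= l)%N -> (level y i < level y j) = (i < j)%N.
Proof. by move=> il jl; rewrite ltNge level_le // -ltnNge. Qed.

Lemma level0 : level y 0 = 0.
Proof.
have z_in : 0 \in levels y by rewrite mem_levels mem_head.
apply/le_anti/andP; split.
  (* The value 0 sits at some index, which is at least that of the head. *)
  rewrite -[leRHS](nth_index 0 z_in) level_le //.
  by rewrite -ltnS -size_levels index_mem.
have : level y 0 \in levels y by rewrite mem_nth // size_levels.
by rewrite mem_levels inE => /predU1P[->|/mapP[v _ ->]].
Qed.

Lemma level_index v : exists2 m, (m <= l)%N & y v = level y m.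
Proof.
have yv : y v \in levels y by rewrite mem_levels inE map_f ?orbT ?mem_enum.
exists (index (y v) (levels y)); last by rewrite /level nth_index.
by rewrite -ltnS -size_levels index_mem.
Qed.

(** A level of positive index exceeds [level y 0 = 0], so it cannot be the inserted 0 and must come
    from a vertex. *)
Lemma level_attained j : (j < l)%N -> exists v, y v = level y j.+1.
Proof.
move=> jl.
have : level y j.+1 \in levels y by rewrite mem_nth // size_levels.
rewrite mem_levels inE => /predU1P[r0|/mapP[v _ ->]]; last by exists v.
by have := level_lt (leq0n l) jl; rewrite r0 level0 ltxx.
Qed.

Lemma sub_level_set i j :
  (i < l)%N -> (j < l)%N ->
  (level_set y i.+1 \subset level_set y j.+1) = (j <= i)%N.
Proof.
move=> il jl; apply/subsetP/idP => [sub|ji v]; last first.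
  by rewrite !inE; apply: le_trans; rewrite level_le.
have [v yv] := level_attained il.
(* A vertex whose value is exactly [level y i.+1] lies in the smaller set; its membership in the
   larger one compares the two levels. *)
by have := sub v; rewrite !inE yv lexx level_le // => /(_ isT).
Qed.

Lemma level_set_inj : injective (fun j : 'I_l => level_set y j.+1).
Proof.
move=> i j /= eq_ij; apply/val_inj/anti_leq/andP; split.
  by rewrite -(sub_level_set (ltn_ord j) (ltn_ord i)) eq_ij.
by rewrite -(sub_level_set (ltn_ord i) (ltn_ord j)) eq_ij.
Qed.

(** By injectivity the sum has at most one term, the one chosen by [pick]; as a sum it can be
    exchanged with the sum over [S]. *)
Lemma lp_roundingE S :
  lp_rounding y S = \sum_(j < l | level_set y j.+1 == S)
                      (level y j.+1 - level y j) * #|level_set y j.+1|%:R.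
Proof.
rewrite ffunE; case: pickP => [j /eqP ->|noS].
  by rewrite (big_pred1 j) // => i; rewrite (inj_eq level_set_inj).
by rewrite big_pred0 // => j; rewrite eq_sym; apply: noS.
Qed.

Lemma lp_rounding_ge0 S : 0 <= lp_rounding y S.
Proof.
rewrite lp_roundingE; apply: sumr_ge0 => j _.
by rewrite mulr_ge0 ?subr_ge0 ?level_le // ltnW.
Qed.

Lemma sum_level_increments v :
  \sum_(j < l | level y j.+1 <= y v) (level y j.+1 - level y j) = y v.
Proof.
have [m ml ->] := level_index v.
(* With [y v] at index [m], the condition becomes [j.+1 <= m]: an initial segment, telescoping to
   [level y m - level y 0]. *)
rewrite (eq_bigl (fun j : 'I_l => (j < m)%N)) => [|j]; last by rewrite level_le.
rewrite -(big_ord_widen l (fun j => level y j.+1 - level y j)) //.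
by rewrite -(big_mkord xpredT (fun j => level y j.+1 - level y j))
  telescope_sumr // level0 subr0.
Qed.

Lemma sum_lp_rounding : \sum_S lp_rounding y S = \sum_v y v.
Proof.
under eq_bigr do rewrite lp_roundingE.
under [RHS]eq_bigr do rewrite -sum_level_increments.
rewrite (exchange_big_dep xpredT) // [RHS](exchange_big_dep xpredT) //=.
(* For fixed [j], only [S = level_set y j.+1] remains on the left; on the right a constant is summed
   over the vertices of that set. *)
apply: eq_bigr => j _; rewrite (big_pred1 (level_set y j.+1)) => [|S].
  by rewrite sumr_const mulr_natr cardsE.
by rewrite eq_sym.
Qed.

Lemma hierarchical_lp_rounding : hierarchical (lp_rounding y).
Proof.
have suppP S : S \in supp (lp_rounding y) ->
    exists j : 'I_l, S = level_set y j.+1.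
  rewrite inE ffunE; case: pickP => [j /eqP -> _|_]; first by exists j.
  by rewrite ltxx.
move=> S T /suppP[i ->] /suppP[j ->]; apply/orP.
by rewrite !sub_level_set // leq_total.
Qed.

End Levels.

Theorem proposition5p4 (R : realType) (V : finType) (k : nat)
    (V_gt0 : (0 < #|V|)%N) (k_gt0 : (0 < k)%N)
    (G : multilayer_network V k) (w : 'I_k -> {set V} -> R)
    (w_gt0 : forall i e, e \in G i -> 0 < w i e)
    (alpha beta : 'I_k -> R) (alpha_ge0 : forall i, 0 <= alpha i)
    (p : {ffun {set V} -> R})
    (p_output : lp_algorithm_output G w alpha beta p) :
  distribution p /\ hierarchical p.
Proof.
have [x [y [t [[[_ _ y_sum _ y_ge0] _] ->]]]] := p_output.
split; last exact: hierarchical_lp_rounding.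
split=> [S|]; first exact: lp_rounding_ge0.
by rewrite sum_lp_rounding.
Qed.
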